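(* Let $S_1,\dots,S_m\subseteq\mathbb{F}_q$ with $\#S_1=\cdots=\#S_m=s$, and let $X_1^{i_1}X_2^{i_2}\cdots X_m^{i_m}\in\Delta(s,\dots,s)$ with $i_1\le i_2$. Let $$L_1=\{N\in\Delta(s,\dots,s)\mid N\preceq_{\deg}X_1^{i_1}X_2^{i_2}X_3^{i_3}\cdots X_m^{i_m}\},\quad L_2=\{N\in\Delta(s,\dots,s)\mid N\prec_{\deg}X_1^{i_2}X_2^{i_1}X_3^{i_3}\cdots X_m^{i_m}\}.$$ Then $C(L_1)$, $C(L_2)$ have length $n=s^m$ and codimension $\ell=i_2-i_1+1$, and $$M_1(C(L_1),C(L_2))=(s-i_1)\cdots(s-i_m),\qquad M_1(C(L_2)^\perp,C(L_1)^\perp)\ge(i_1+1)\cdots(i_m+1).$$ Moreover, letting $T=\{X_1^{i_2-w}X_2^{i_1+w}X_3^{i_3}\cdots X_m^{i_m}\mid w=0,\dots,i_2-i_1\}$, for $v=2,\dots,\ell$: $$M_v(C(L_1),C(L_2))=\min\{D(K)\mid K\subseteq T,\ \#K=v\},\qquad M_v(C(L_2)^\perp,C(L_1)^\perp)\ge\min\{D^\perp(K)\mid K\subseteq T,\ \#K=v\}.$$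
   Context: $q$ is a prime power. $S=S_1\times\cdots\times S_m=\{\alpha_1,\dots,\alpha_n\}$, $n=s^m$. $\Delta(s,\dots,s)=\{X_1^{a_1}\cdots X_m^{a_m}\mid 0\le a_t<s\}$. For $L\subseteq\Delta(s,\dots,s)$, $C(L)\subseteq\mathbb{F}_q^n$ is the span of $(N(\alpha_1),\dots,N(\alpha_n))$, $N\in L$; $C^\perp$ is the Euclidean dual. $\prec_{\deg}$ is the degree lexicographic ordering: $X_1^{a_1}\cdots X_m^{a_m}\prec_{\deg}X_1^{b_1}\cdots X_m^{b_m}$ iff either $\sum a_t<\sum b_t$, or $\sum a_t=\sum b_t$ and the rightmost nonzero entry of $(b_1-a_1,\dots,b_m-a_m)$ is positive. For $K\subseteq\Delta(s,\dots,s)$: $D(K)=\#\{N\in\Delta(s,\dots,s)\mid N$ is divisible by some $M\in K\}$, $D^\perp(K)=\#\{N\in\Delta(s,\dots,s)\mid N$ divides some $M\in K\}$. For linear codes $C_2\subsetneq C_1\subseteq\mathbb{F}_q^n$ and $1\le v\le\dim C_1-\dim C_2$, $M_v(C_1,C_2)=\min\{\#\mathrm{Supp}\,U\mid U\subseteq C_1\text{ subspace},\ \dim U=v,\ U\cap C_2=\{\vec0\}\}$, with $\mathrm{Supp}\,U$ the set of coordinates where some word of $U$ is nonzero. *)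

(* Defs.v *)
From HB Require Import structures.
From mathcomp Require Import all_boot all_order all_algebra.
Set Implicit Arguments. Unset Strict Implicit. Unset Printing Implicit Defensive.
Import GRing.Theory.
Local Open Scope ring_scope.

(* Exponent vectors (a_1,...,a_m) with 0 <= a_t < s; they index the
   monomials X_1^{a_1} ... X_m^{a_m} of Delta(s,...,s). *)
Notation exps m s := {ffun 'I_m -> 'I_s}.

Definition degsum (m s : nat) (a : exps m s) : nat := (\sum_(t < m) (a t : nat))%N.

Definition deglex_lt (m s : nat) (a b : exps m s) : bool :=
  (degsum a < degsum b)%N ||
  ((degsum a == degsum b) &&
   [exists t : 'I_m, (a t < b t)%N && [forall u : 'I_m, (t < u)%N ==> (a u == b u)]]).

Definition deglex_le (m s : nat) (a b : exps m s) : bool :=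
  (a == b) || deglex_lt a b.

Definition evrow (F : fieldType) (n m s : nat) (alpha : 'I_n -> {ffun 'I_m -> F})
  (a : exps m s) : 'rV[F]_n :=
  \row_(j < n) \prod_(t < m) (alpha j t) ^+ (a t).

Definition code (F : fieldType) (n m s : nat) (alpha : 'I_n -> {ffun 'I_m -> F})
  (L : {set exps m s}) : 'M[F]_n :=
  (\sum_(a in L) <<evrow alpha a>>)%MS.

Definition dual (F : fieldType) (n : nat) (C : 'M[F]_n) : 'M[F]_n := kermx C^T.

Definition supp (F : finFieldType) (n : nat) (U : 'M[F]_n) : nat :=
  #|[set j : 'I_n | [exists u : 'rV[F]_n, (u <= U)%MS && (u 0 j != 0)]]|.

(* relative generalized Hamming weight M_v(C1, C2) (minimum over subspaces
   U <= C1 of dimension v with U /\ C2 = 0; default n if there is none) *)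
Definition Mv (F : finFieldType) (n v : nat) (C1 C2 : 'M[F]_n) : nat :=
  \big[minn/n]_(U : 'M[F]_n | (U <= C1)%MS && (\rank U == v) && (\rank (U :&: C2)%MS == 0))
     supp U.

Definition Dset (m s : nat) (K : {set exps m s}) : nat :=
  #|[set N : exps m s | [exists M in K, [forall t, (M t <= N t)%N]]]|.
Definition Dperp (m s : nat) (K : {set exps m s}) : nat :=
  #|[set N : exps m s | [exists M in K, [forall t, (N t <= M t)%N]]]|.

(* min { f K | K subset T, #K = v }  (default #Delta = s^m if empty) *)
Definition minsub (m s : nat) (f : {set exps m s} -> nat) (T : {set exps m s}) (v : nat) : nat :=
  \big[minn/(s ^ m)%N]_(K : {set exps m s} | (K \subset T) && (#|K| == v)) f K.

(* Main.v *)
Require Import Defs.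
From HB Require Import structures.
From mathcomp Require Import all_boot all_order all_algebra.
From mathcomp Require Import zify.
Import GRing.Theory.
Local Open Scope ring_scope.

(** The footprint (Feng-Rao) method. Expand words in the basis of evaluated
monomials of the box. A subspace [U] has exactly [\rank U] leading monomials;
if [U] lies in [C(L1)] and meets [C(L2)] trivially, they form a set [K] inside
[L1 :\: L2]. Multiplying a word led by [M] by a monomial [P] with [M * P] in the
box gives a word led by [M * P] whose support is no larger, so every multiple of
an element of [K] leads a word supported in [Supp U], and triangularity yields
[Dset K <= #Supp U]. Products of linear factors, with leading monomials in
[K], attain the bound. On the dual side, expand with respect to the dual basis
and the reversed order: multiplication by [P] then divides the leading monomial
by [P], and the same argument gives [Dperp K <= #Supp U]. Finally
[L1 :\: L2] is the window [T], and for one monomial the products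
[(s - a) * (s - b)] and [(a + 1) * (b + 1)] with [a + b] fixed are smallest at
the extreme exponents. *)

Set Implicit Arguments.
Unset Strict Implicit.

(** * Leading indices and rank *)

Lemma rank_sum_rows_le_card (F : fieldType) n (I : finType) (A : {set I})
    (f : I -> 'rV[F]_n) :
  (\rank (\sum_(a in A) <<f a>>)%MS <= #|A|)%N.
Proof.
rewrite -sum1_card.
elim/big_ind2: _ => [|B1 c1 B2 c2 h1 h2|a _]; first by rewrite mxrank0.
  by apply: leq_trans (leq_add h1 h2); case: (mxrank_adds_leqif B1 B2).
by rewrite genmxE rank_leq_row.
Qed.

Section LeadingIndices.

Variables (F : fieldType) (n : nat) (D : finType) (lt : rel D).
Hypotheses (lt_irr : irreflexive lt) (lt_trans : transitive lt).
Variable G : 'M[F]_(n, #|D|).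

(** [G] stays abstract so that one theory serves two coordinate systems on words: [pinvmx evmx] with
    the order, and [evmx^T] with the reversed order. *)
Definition lcoef (u : 'rV[F]_n) (N : D) : F := (u *m G) 0 (enum_rank N).

Definition lead (u : 'rV[F]_n) (N : D) : bool :=
  (lcoef u N != 0) && [forall N', lt N N' ==> (lcoef u N' == 0)].

Lemma lcoef_sum (I : Type) (r : seq I) (P : pred I) (c : I -> F)
    (f : I -> 'rV[F]_n) N :
  lcoef (\sum_(k <- r | P k) c k *: f k) N =
  \sum_(k <- r | P k) c k * lcoef (f k) N.
Proof.
rewrite /lcoef mulmx_suml summxE; apply: eq_bigr => k _.
by rewrite -scalemxAl mxE.
Qed.

Lemma lcoefB u v N : lcoef (u - v) N = lcoef u N - lcoef v N.
Proof. by rewrite /lcoef mulmxBl !mxE. Qed.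

Lemma lcoef_eq0 u : (forall N, lcoef u N = 0) -> u *m G = 0.
Proof.
move=> h; apply/rowP => k; rewrite [RHS]mxE.
by have := h (enum_val k); rewrite /lcoef enum_valK.
Qed.

(** The number of predecessors strictly increases along [lt], so an element of [P] with the most
    predecessors is maximal. *)
Lemma ex_lt_max (P : pred D) N0 :
  P N0 -> exists2 N, P N & forall N', lt N N' -> ~~ P N'.
Proof.
move=> PN0; pose r N := #|[set N' | lt N' N]|.
case: (arg_maxnP r PN0) => N PN maxN; exists N => // N' ltNN'.
apply/negP => /maxN; rewrite /geq /r /= leqNgt => /negP[].
apply: proper_card; apply/properP; split.
  by apply/subsetP => x; rewrite !inE => /lt_trans; apply.
by exists N; rewrite !inE // lt_irr.
Qed.

Lemma ex_lead u : u *m G != 0 -> exists N, lead u N.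
Proof.
move=> nz; have [N0 h0] : exists N, lcoef u N != 0.
  apply/existsP; apply: contraR nz; rewrite negb_exists => /forallP h.
  by apply/eqP/lcoef_eq0 => N; apply/eqP; rewrite -[_ == _]negbK h.
have [N hN maxN] := @ex_lt_max (fun N => lcoef u N != 0) _ h0.
exists N; rewrite /lead hN; apply/forallP => N'; apply/implyP => /maxN.
by rewrite negbK.
Qed.

(** The projection of [U] onto the coordinates in [A] is injective: a nonzero word of [U] has its
    leading coordinate in [A], and that one survives. *)
Lemma rank_le_card_leads (U : 'M[F]_n) (A : {set D}) :
    (forall u : 'rV[F]_n, (u <= U)%MS -> u *m G = 0 -> u = 0) ->
    (forall u N, (u <= U)%MS -> lead u N -> N \in A) ->
  (\rank U <= #|A|)%N.
Proof.
move=> injG leadA.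
pose H := \matrix_(j < n, k < #|A|) G j (enum_rank (enum_val k)).
have /mxrank_injP <- : (U :&: kermx H)%MS == 0; last exact: rank_leq_col.
rewrite -submx0; apply/rV_subP => u; rewrite sub_capmx submx0.
case/andP => uU /sub_kermxP uH; apply/eqP/injG => //; apply/eqP.
apply: contraT => /ex_lead[N lN]; have NA := leadA _ _ uU lN.
case/andP: lN => /negP[]; apply/eqP.
have /rowP/(_ (enum_rank_in NA N)) := uH; rewrite [RHS]mxE => <-.
by rewrite /lcoef !mxE; apply: eq_bigr => j _; rewrite !mxE enum_rankK_in.
Qed.

Hypothesis lt_total : forall N N', N != N' -> lt N N' || lt N' N.

(** Words with distinct leads are independent: in a vanishing combination, the largest lead with
    nonzero coefficient occurs in only one of the words that take part. *)
Lemma card_leads_le_rank (U : 'M[F]_n) (A : {set D}) :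
    (forall N, N \in A -> exists2 u : 'rV[F]_n, (u <= U)%MS & lead u N) ->
  (#|A| <= \rank U)%N.
Proof.
move=> leadA.
have [k|w wU wlead] := @fin_all_exists2 'I_#|A| (fun=> 'rV[F]_n)
    (fun k u => (u <= U)%MS) (fun k u => lead u (enum_val k)).
  exact/leadA/enum_valP.
pose W := \matrix_(k < #|A|) w k.
have WU : (W <= U)%MS by apply/row_subP => k; rewrite rowK.
suff /eqP <- : row_free W by apply: mxrankS.
apply: inj_row_free => v vW0; apply/rowP => k; rewrite [RHS]mxE.
apply/eqP; apply: contraT => vk.
pose P N := [exists k, (v 0 k != 0) && (enum_val k == N :> D)].
have PN0 : P (enum_val k) by apply/existsP; exists k; rewrite vk eqxx.
have [N /existsP[k0 /andP[vk0 /eqP <-]] maxN] := @ex_lt_max P _ PN0.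
have : lcoef (v *m W) (enum_val k0) = 0 by rewrite vW0 /lcoef mul0mx mxE.
rewrite mulmx_sum_row lcoef_sum (bigD1 k0) //= big1 ?addr0 => [|k1 k10].
  rewrite rowK => /eqP; rewrite mulf_eq0 (negPf vk0) /=.
  by have /andP[/negPf->] := wlead k0.
rewrite rowK; have [->|vk1] := eqVneq (v 0 k1) 0; first by rewrite mul0r.
have : enum_val k1 != enum_val k0 by rewrite (inj_eq enum_val_inj).
case/lt_total/orP => [lt10|/maxN/existsP[]]; last first.
  by exists k1; rewrite vk1 eqxx.
have /andP[_ /forallP/(_ (enum_val k0))] := wlead k1.
by rewrite lt10 => /eqP ->; rewrite mulr0.
Qed.

(** The words supported on [J] lie in the span of [#|J|] unit vectors. *)
Lemma card_leads_le_card (J : {set 'I_n}) (A : {set D}) :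
    (forall N, N \in A -> exists2 u : 'rV[F]_n,
      (forall j, j \notin J -> u 0 j = 0) & lead u N) ->
  (#|A| <= #|J|)%N.
Proof.
move=> leadA.
pose U := (\sum_(j in J) <<delta_mx 0 j : 'rV[F]_n>>)%MS.
apply: (@leq_trans (\rank U)); last exact: rank_sum_rows_le_card.
apply: card_leads_le_rank => N /leadA[u uJ lu]; exists u => //.
rewrite [u]row_sum_delta; apply: summx_sub => j _.
have [jJ|/uJ->] := boolP (j \in J); last by rewrite scale0r sub0mx.
by apply: scalemx_sub; apply: (sumsmx_sup j) => //; rewrite genmxE.
Qed.

End LeadingIndices.

(** * Minima over finite families *)

Lemma geq_bigminn (I : finType) (P : pred I) (f : I -> nat) d x :
  (x <= d)%N -> (forall k, P k -> (x <= f k)%N) ->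
  (x <= \big[minn/d]_(k | P k) f k)%N.
Proof.
by move=> xd xf; elim/big_ind: _ => // a b xa xb; rewrite leq_min xa xb.
Qed.

(** The default [d] is not neutral for [minn], so the index [k] is reached by induction along the
    enumeration. *)
Lemma bigminn_leq (I : finType) (P : pred I) (f : I -> nat) d k :
  P k -> (\big[minn/d]_(k | P k) f k <= f k)%N.
Proof.
rewrite unlock; have : k \in index_enum I by rewrite mem_index_enum.
elim: (index_enum I) => //= a r IH; rewrite inE => /predU1P[<- ->|kr Pk].
  exact: geq_minl.
by case: ifP => _; rewrite ?geq_min IH // orbT.
Qed.

Lemma bigminn_leq_default (I : finType) (P : pred I) (f : I -> nat) d :
  (\big[minn/d]_(k | P k) f k <= d)%N.
Proof. by elim/big_rec: _ => // k x _ xd; rewrite geq_min xd orbT. Qed.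

(** * The degree lexicographic order *)

Section Deglex.

Variables m s : nat.
Implicit Types a b c : exps m s.

Definition dvd_exps a b : bool := [forall t, a t <= b t]%N.

Lemma dvd_expsP a b : reflect (forall t, a t <= b t)%N (dvd_exps a b).
Proof. exact: forallP. Qed.

Lemma deglexP a b :
  reflect ((degsum a < degsum b)%N \/ degsum a = degsum b /\
    exists2 t : 'I_m, (a t < b t)%N & forall u : 'I_m, (t < u)%N -> a u = b u)
  (deglex_lt a b).
Proof.
apply: (iffP orP) => [[->|/andP[/eqP-> /existsP[t /andP[ltab h]]]]|];
    [by left| right; split=> // | case=> [->|[-> [t ltab h]]]; first by left].
  exists t => // u tu; apply/eqP.
  exact: (implyP (forallP h u)).
right; rewrite eqxx; apply/existsP; exists t; rewrite ltab.
by apply/forallP => u; apply/implyP => /h ->.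
Qed.

Lemma deglex_irr : irreflexive (@deglex_lt m s).
Proof.
by move=> a; apply/deglexP => -[|[_ [t]]]; rewrite ltnn.
Qed.

Lemma deglex_trans : transitive (@deglex_lt m s).
Proof.
move=> b a c /deglexP hab /deglexP hbc; apply/deglexP.
case: hab hbc => [dab|[dab [t tab hab]]] [dbc|[dbc [u ubc hbc]]]; try by left; lia.
right; split; first by rewrite dab.
(* The comparison of [a] with [c] is decided at the later of the positions [t] and [u]. *)
have [ltut|lttu|/val_inj ett] := ltngtP u t.
- exists t => [|v tv]; first by rewrite -hbc.
  by rewrite hab // hbc // (ltn_trans ltut).
- exists u => [|v uv]; first by rewrite hab.
  by rewrite hab ?hbc // (ltn_trans lttu).
subst u; exists t => [|v tv]; first exact: ltn_trans tab ubc.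
by rewrite hab // hbc.
Qed.

Lemma deglex_total a b : a != b -> deglex_lt a b || deglex_lt b a.
Proof.
move=> neq; have [t0 ht0] : exists t, a t != b t.
  apply/existsP; apply: contraR neq; rewrite negb_exists => /forallP h.
  by apply/eqP/ffunP => t; apply/eqP; rewrite -[_ == _]negbK h.
(* The rightmost difference settles a tie in degree. *)
have [t ht maxt] := @arg_maxnP _ t0 (fun t => a t != b t) (fun t => val t) ht0.
have eqab (u : 'I_m) : (t < u)%N -> a u = b u.
  by move=> tu; apply/eqP; apply: contraLR tu => /maxt; rewrite /geq /= -leqNgt.
have [lt|lt|eqd] := ltngtP (degsum a) (degsum b).
- by apply/orP; left; apply/deglexP; left.
- by apply/orP; right; apply/deglexP; left.
have /orP[lt|lt] : (a t < b t)%N || (b t < a t)%N by rewrite -neq_ltn.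
  by apply/orP; left; apply/deglexP; right; split=> //; exists t.
apply/orP; right; apply/deglexP; right; split=> //; exists t => // u.
by move/eqab.
Qed.

(** The dichotomy separates a drop in degree from the case where the tie-break of the order must be
    consulted. *)
Lemma degsum_leqif (f g : 'I_m -> nat) : (forall t, f t <= g t)%N ->
  (\sum_(t < m) f t < \sum_(t < m) g t)%N \/ f =1 g.
Proof.
move=> le.
have [le_sum] := leqif_sum (fun t (_ : true) => leqif_eq (le t)).
have [-> /esym/forallP h|ne _] := eqVneq; last by left; rewrite ltn_neqAle ne.
by right => t; apply/eqP/h.
Qed.

(* A product of monomials, once reduced on the grid, only involves divisors of
   that product; this takes the place of Groebner bases. *)
Lemma deglex_translate (a b c p d : exps m s) :
    deglex_lt a b -> (forall t, b t + p t = d t :> nat)%N ->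
    (forall t, c t <= a t + p t)%N ->
  deglex_lt c d.
Proof.
move=> ltab bp cap; apply/deglexP.
have sd : degsum d = (degsum b + degsum p)%N.
  by rewrite /degsum -big_split; apply: eq_bigr => t _; rewrite -bp.
have sa : (\sum_(t < m) (a t + p t) = degsum a + degsum p)%N.
  by rewrite /degsum -big_split.
have dab : (degsum a <= degsum b)%N.
  by case/deglexP: ltab => [/ltnW|[->]].
have [sc|ce] := degsum_leqif cap.
  by left; rewrite sd; apply: leq_trans sc _; rewrite sa leq_add2r.
have sc : degsum c = (degsum a + degsum p)%N.
  by rewrite -sa; apply: eq_bigr => t _; rewrite -ce.
case/deglexP: ltab => [ltd|[eqd [t tab hab]]]; first by left; lia.
right; split; first by lia.
exists t => [|u tu]; first by have := bp t; have /= := ce t; lia.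
by apply/val_inj; rewrite /= -bp ce hab.
Qed.

Lemma dvd_deglex_le a b : dvd_exps a b -> deglex_le a b.
Proof.
move=> /dvd_expsP /degsum_leqif[lt|eq]; first by rewrite /deglex_le /deglex_lt lt orbT.
by apply/orP; left; apply/eqP/ffunP => t; apply/val_inj/eq.
Qed.

End Deglex.

(** * Evaluation of monomials on the grid *)

Section Evaluation.

Variables (F : finFieldType) (m s n : nat) (S : 'I_m -> {set F}).
Hypothesis hS : forall t, #|S t| = s.
Variable alpha : 'I_n -> {ffun 'I_m -> F}.
Hypothesis alpha_inj : injective alpha.
Hypothesis alpha_onto : forall x : {ffun 'I_m -> F},
  (exists j, alpha j = x) <-> (forall t, x t \in S t).

Implicit Types (N M P Q : exps m s) (u : 'rV[F]_n).
Local Notation ev := (evrow alpha).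
Local Notation D := (exps m s).

Lemma alphaS j t : alpha j t \in S t.
Proof. by have /(_ t) := (alpha_onto (alpha j)).1 (ex_intro _ j erefl). Qed.

Lemma alpha_neq j k : j != k -> exists t, alpha j t != alpha k t.
Proof.
move=> jk; apply/existsP; apply: contraR jk; rewrite negb_exists => /forallP h.
by apply/eqP/alpha_inj/ffunP => t; apply/eqP; rewrite -[_ == _]negbK h.
Qed.

Lemma card_exps : #|D| = (s ^ m)%N.
Proof. by rewrite card_ffun !card_ord. Qed.

Lemma card_points : n = (s ^ m)%N.
Proof.
rewrite -[LHS]card_ord -(card_codom alpha_inj).
rewrite (@eq_card _ _ (family (fun t => mem (S t)))) => [|x].
  rewrite card_family foldrE big_map big_enum /=.
  by rewrite (eq_bigr (fun=> s)) ?prod_nat_const ?card_ord.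
apply/codomP/familyP => [[j ->] t|xS]; first exact: alphaS.
by have [j <-] := (alpha_onto x).2 xS; exists j.
Qed.

Definition prodrow (p : 'I_m -> {poly F}) : 'rV[F]_n :=
  \row_j \prod_(t < m) (p t).[alpha j t].

(** The product is distributed over the sums of powers; the size bound keeps every exponent inside
    the box. *)
Lemma prodrowE (p : 'I_m -> {poly F}) : (forall t, size (p t) <= s)%N ->
  prodrow p = \sum_(N : D) (\prod_(t < m) (p t)`_(N t)) *: ev N.
Proof.
move=> sp; apply/rowP => j; rewrite mxE summxE.
under eq_bigr => t _ do rewrite (horner_coef_wide _ (sp t)).
rewrite bigA_distr_bigA /=; apply: eq_bigr => N _.
by rewrite !mxE -big_split.
Qed.

Definition evmx : 'M[F]_(#|D|, n) := \matrix_k ev (enum_val k).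

Lemma ev_evmx N : ev N = delta_mx 0 (enum_rank N) *m evmx.
Proof. by rewrite -rowE rowK enum_rankK. Qed.

(** Interpolation: each unit vector is a scalar multiple of an evaluated product of univariate
    polynomials of degree [s - 1], vanishing on [S t] except at the coordinate of the chosen
    point. *)
Lemma evmx_full : row_full evmx.
Proof.
rewrite -sub1mx; apply/row_subP => j; rewrite row1.
pose p t := \prod_(a <- rem (alpha j t) (enum (S t))) ('X - a%:P) : {poly F}.
have jS t : alpha j t \in enum (S t) by rewrite mem_enum alphaS.
have sp t : (size (p t) <= s)%N.
  rewrite size_prod_XsubC size_rem // -cardE hS prednK // -(hS t).
  by apply/card_gt0P; exists (alpha j t); apply: alphaS.
have rootp k t : root (p t) (alpha k t) = (alpha k t != alpha j t).
  rewrite root_prod_XsubC mem_rem_uniq ?enum_uniq // !inE mem_enum alphaS.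
  by rewrite andbT.
have pE : prodrow p = prodrow p 0 j *: delta_mx 0 j.
  apply/rowP => k; rewrite [RHS]mxE [delta_mx _ _ _ _]mxE /=.
  have [->|kj] := eqVneq k j; first by rewrite mulr1.
  have [t kjt] := alpha_neq kj; rewrite mulr0 mxE (bigD1 t) //=.
  by rewrite -rootp in kjt; rewrite (rootP kjt) mul0r.
have nz : prodrow p 0 j != 0.
  by rewrite mxE; apply/prodf_neq0 => t _; have := rootp j t; rewrite eqxx => /negbT.
rewrite -(eqmx_scale _ nz) -pE prodrowE //.
apply: summx_sub => N _; rewrite scalemx_sub // ev_evmx.
exact: submxMl.
Qed.

Lemma evmx_free : row_free evmx.
Proof. by rewrite /row_free [eqbRHS]card_exps -card_points; apply: evmx_full. Qed.

(* [coefp] gives the coordinates in the basis of evaluated monomials, [coefd]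
   those in its dual basis for the standard bilinear form. *)
Local Notation coefp := (lcoef (pinvmx evmx)).
Local Notation coefd := (lcoef evmx^T).

Lemma coefp_ev N M : coefp (ev N) M = (N == M)%:R.
Proof.
rewrite /lcoef ev_evmx -mulmxA mulmxVp ?evmx_free // mulmx1 mxE eqxx /=.
by rewrite (inj_eq enum_rank_inj) eq_sym.
Qed.

Lemma coefp_inj u : u *m pinvmx evmx = 0 -> u = 0.
Proof.
move=> h; rewrite -[u](@mulmxKpV _ _ _ _ _ evmx) ?h ?mul0mx //.
by apply: submx_full; apply: evmx_full.
Qed.

Lemma coefp_decomp u : u = \sum_(N : D) coefp u N *: ev N.
Proof.
apply/eqP; rewrite -subr_eq0; apply/eqP/coefp_inj/lcoef_eq0 => N.
rewrite lcoefB lcoef_sum (bigD1 N) //= coefp_ev eqxx mulr1 big1 => [|M MN].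
  by rewrite addr0 subrr.
by rewrite coefp_ev (negPf MN) mulr0.
Qed.

Lemma coefp_prodrow (p : 'I_m -> {poly F}) N : (forall t, size (p t) <= s)%N ->
  coefp (prodrow p) N = \prod_(t < m) (p t)`_(N t).
Proof.
move=> sp; rewrite prodrowE // lcoef_sum (bigD1 N) //= [X in _ + X]big1 ?addr0 => [|M MN].
  by rewrite coefp_ev eqxx mulr1.
by rewrite coefp_ev (negPf MN) mulr0.
Qed.

(** The coordinate is the inner product of [u] with [ev N], which turns orthogonality into vanishing
    of [coefd]. *)
Lemma coefdE u N : coefd u N = \sum_j u 0 j * ev N 0 j.
Proof.
by rewrite /lcoef mxE; apply: eq_bigr => j _; rewrite !mxE enum_rankK.
Qed.

Lemma coefd_inj u : u *m evmx^T = 0 -> u = 0.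
Proof.
move=> h; apply: (can_inj (@trmxK _ _ _)); apply: (row_full_inj evmx_full).
by rewrite trmx0 mulmx0 -[evmx]trmxK -trmx_mul h trmx0.
Qed.

(** * Multiplication by a monomial and leading monomials *)

Definition pmul (u : 'rV[F]_n) P : 'rV[F]_n := \row_j (u 0 j * ev P 0 j).

(** The vanishing polynomial of [S t]: reduction modulo it leaves the values on the grid unchanged
    and brings degrees below [s]. *)
Definition gridpoly t : {poly F} := \prod_(a <- enum (S t)) ('X - a%:P).

Lemma pmul_evE N P :
  pmul (ev N) P = prodrow (fun t => 'X^(N t + P t) %% gridpoly t).
Proof.
apply/rowP => j; rewrite !mxE -big_split; apply: eq_bigr => t _ /=.
rewrite -exprD -hornerXn [in LHS](divp_eq 'X^(N t + P t) (gridpoly t)).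
rewrite hornerD hornerM (_ : (gridpoly t).[_] = 0) ?mulr0 ?add0r //.
by apply/rootP; rewrite root_prod_XsubC mem_enum alphaS.
Qed.

Lemma size_gridpoly t : size (gridpoly t) = s.+1.
Proof. by rewrite size_prod_XsubC -cardE hS. Qed.

Lemma size_modp_gridpoly t (k : nat) : (size ('X^k %% gridpoly t)%R <= s)%N.
Proof.
rewrite -ltnS -(size_gridpoly t) ltn_modp -size_poly_eq0 size_gridpoly //.
Qed.

(** A remainder has degree at most that of the dividend, so reduction only produces divisors of the
    formal product [N * P]. *)
Lemma coefp_pmul_ev N P M :
  coefp (pmul (ev N) P) M != 0 -> forall t, (M t <= N t + P t)%N.
Proof.
rewrite pmul_evE coefp_prodrow => [/prodf_neq0 nz t|t]; last first.
  exact: size_modp_gridpoly.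
have := nz t isT; apply: contraNT; rewrite -ltnNge => ltM.
apply/eqP/nth_default; apply: leq_trans ltM; rewrite -(size_polyXn F).
exact: leq_modp.
Qed.

Lemma pmul_ev N P M : (forall t, N t + P t = M t :> nat)%N -> pmul (ev N) P = ev M.
Proof.
move=> h; apply/rowP => j; rewrite !mxE -big_split.
by apply: eq_bigr => t _ /=; rewrite -exprD h.
Qed.

Definition leadp := lead (@deglex_lt m s) (pinvmx evmx).
Definition leadd := lead (fun a b => @deglex_lt m s b a) evmx^T.

(** For [M'] below [M], each monomial in the reduction of [M' * P] divides the formal product and so
    lies strictly below [Q]; only [M] itself contributes at [Q] or above. *)
Lemma leadp_pmul u M P Q :
    leadp u M -> (forall t, M t + P t = Q t :> nat)%N ->
  leadp (pmul u P) Q.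
Proof.
case/andP=> uM /forallP u0 MP.
have uE N : coefp (pmul u P) N = \sum_(M : D) coefp u M * coefp (pmul (ev M) P) N.
  rewrite -lcoef_sum; congr (coefp _ N); apply/rowP => j.
  rewrite mxE [u in LHS]coefp_decomp !summxE mulr_suml.
  by apply: eq_bigr => M' _; rewrite !mxE mulrA.
have cE N : ~~ deglex_lt N Q ->
    coefp (pmul u P) N = coefp u M * (Q == N)%:R.
  move=> NQ; rewrite uE (bigD1 M) //= big1 ?addr0 => [|M' M'M].
    by rewrite (pmul_ev MP) coefp_ev.
  have [->|uM'] := eqVneq (coefp u M') 0; first by rewrite mul0r.
  apply/eqP; rewrite mulf_eq0 (negPf uM') /=; apply: contraR NQ => /coefp_pmul_ev.
  apply: deglex_translate MP.
  case/orP: (deglex_total M'M) => // /(implyP (u0 M')).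
  by rewrite (negPf uM').
rewrite /leadp /lead cE ?deglex_irr // eqxx mulr1 uM /=.
apply/forallP => N; apply/implyP => QN; rewrite cE.
  have [QN'|] := eqVneq Q N; last by rewrite mulr0.
  by rewrite QN' deglex_irr in QN.
by apply/negP => /(deglex_trans QN); rewrite deglex_irr.
Qed.

(** Multiplication by [P] is self-adjoint for the standard bilinear form. The coordinate of
    [pmul u P] at [N] is thus a combination of those of [u] at divisors of [N * P], which lie below
    [M] when [N] lies below [Q]. *)
Lemma leadd_pmul u M P Q :
    leadd u M -> (forall t, Q t + P t = M t :> nat)%N ->
  leadd (pmul u P) Q.
Proof.
case/andP=> uM /forallP u0 QP.
have uE N : coefd (pmul u P) N = \sum_(M : D) coefp (pmul (ev N) P) M * coefd u M.
  under eq_bigr => M' _ do rewrite coefdE mulr_sumr.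
  rewrite exchange_big coefdE; apply: eq_bigr => j _.
  under eq_bigr => M' _ do rewrite mulrCA.
  rewrite -mulr_sumr mxE -mulrA; congr (_ * _).
  rewrite mulrC; have -> : ev N 0 j * ev P 0 j = pmul (ev N) P 0 j by rewrite [RHS]mxE.
  rewrite [in LHS](coefp_decomp (pmul (ev N) P)) summxE.
  by apply: eq_bigr => M' _; rewrite mxE.
apply/andP; split.
  by rewrite uE (pmul_ev QP) (bigD1 M) //= big1 ?addr0 => [|M' M'M];
     rewrite coefp_ev ?eqxx ?mul1r // eq_sym (negPf M'M) mul0r.
apply/forallP => N; apply/implyP => NQ; rewrite uE big1 // => M' _.
have [->|/coefp_pmul_ev M'N] := eqVneq (coefp (pmul (ev N) P) M') 0.
  by rewrite mul0r.
have /(implyP (u0 M'))/eqP -> := deglex_translate NQ QP M'N.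
by rewrite mulr0.
Qed.

(** * Membership in the codes and their duals *)

Lemma sub_codeP (L : {set D}) (u : 'rV[F]_n) :
  reflect (forall N, N \notin L -> coefp u N = 0) (u <= code alpha L)%MS.
Proof.
apply: (iffP idP) => [/sub_sumsmxP[w ->] N NL|h].
  rewrite /lcoef mulmx_suml summxE big1 // => M ML.
  have /sub_rVP[c ->] : (w M *m <<ev M>> <= ev M)%MS.
    by apply: submx_trans (submxMl _ _) _; rewrite genmxE.
  have := coefp_ev M N; rewrite /lcoef -scalemxAl [X in _ -> X = _]mxE => ->.
  by case: eqP => [MN|_]; [rewrite -MN ML in NL | rewrite mulr0].
rewrite [u]coefp_decomp; apply: summx_sub => N _.
have [NL|/h ->] := boolP (N \in L); last by rewrite scale0r sub0mx.
by rewrite scalemx_sub // (sumsmx_sup N) // genmxE.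
Qed.

(** It suffices to test orthogonality on the spanning rows [ev N]. *)
Lemma sub_dual_codeP (L : {set D}) (u : 'rV[F]_n) :
  reflect (forall N, N \in L -> coefd u N = 0) (u <= dual (code alpha L))%MS.
Proof.
have evE N : coefd u N = (u *m (ev N)^T) 0 0.
  by rewrite coefdE mxE; apply: eq_bigr => j _; rewrite !mxE.
apply: (iffP sub_kermxP) => [h N NL|h].
  rewrite evE; have /submxP[x ->] : (ev N <= code alpha L)%MS.
    by apply: (sumsmx_sup N); rewrite ?genmxE.
  by rewrite trmx_mul mulmxA h mul0mx mxE.
apply: (can_inj (@trmxK _ _ _)); rewrite trmx0 trmx_mul trmxK.
apply/sub_kermxP/sumsmx_subP => N NL; rewrite genmxE; apply/sub_kermxP.
apply/rowP => k; rewrite ord1 [RHS]mxE -(h N NL) coefdE mxE.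
by apply: eq_bigr => j _; rewrite !mxE mulrC.
Qed.

Lemma leadp_ev N : leadp (ev N) N.
Proof.
apply/andP; rewrite coefp_ev eqxx oner_eq0; split=> //.
apply/forallP => M; apply/implyP => NM; rewrite coefp_ev.
by have [eNM|_] := eqVneq N M; first by rewrite eNM deglex_irr in NM.
Qed.

Let card_leadp_le_rank := card_leads_le_rank (@deglex_irr m s)
  (@deglex_trans m s) (G := pinvmx evmx) (@deglex_total m s).

Lemma rank_code (L : {set D}) : \rank (code alpha L) = #|L|.
Proof.
apply/eqP; rewrite eqn_leq rank_sum_rows_le_card /=.
apply: card_leadp_le_rank => N NL.
by exists (ev N); [apply: (sumsmx_sup N); rewrite ?genmxE | apply: leadp_ev].
Qed.

(** * Products of linear factors *)

Definition newton N t : {poly F} :=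
  \prod_(a <- take (N t) (enum (S t))) ('X - a%:P).

Lemma size_newton N t : size (newton N t) = (N t).+1.
Proof. by rewrite size_prod_XsubC size_take -cardE hS ltn_ord. Qed.

Lemma size_newton_le N t : (size (newton N t) <= s)%N.
Proof. by rewrite size_newton. Qed.

Lemma coefp_newton N M :
  coefp (prodrow (newton N)) M != 0 -> dvd_exps M N.
Proof.
rewrite coefp_prodrow => [/prodf_neq0 nz|]; last exact: size_newton_le.
apply/dvd_expsP => t; rewrite -ltnS -(size_newton N t) ltnNge.
by apply: contra (nz t isT) => /(nth_default _) ->.
Qed.

(** Each factor is monic of degree [N t], and all monomials that occur divide [N]. *)
Lemma leadp_newton N : leadp (prodrow (newton N)) N.
Proof.
apply/andP; split.
  rewrite coefp_prodrow; last exact: size_newton_le.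
  apply/prodf_neq0 => t _; have /monicP := monic_prod_XsubC
    (take (N t) (enum (S t))) predT id.
  by rewrite /lead_coef -/(newton N t) size_newton /= => ->; apply: oner_neq0.
apply/forallP => M; apply/implyP => NM; apply: contraT => /coefp_newton.
move=> /dvd_deglex_le /orP[/eqP eMN|MN]; first by rewrite eMN deglex_irr in NM.
by have := deglex_trans NM MN; rewrite deglex_irr.
Qed.

Lemma point_index_subproof j t : (index (alpha j t) (enum (S t)) < s)%N.
Proof. by rewrite -(hS t) cardE index_mem mem_enum alphaS. Qed.

(** Identifies grid points with exponent vectors, so that supports can be compared with sets of
    monomials. *)
Definition point_index j : D := [ffun t => Ordinal (point_index_subproof j t)].

Lemma point_index_inj : injective point_index.
Proof.
move=> j k /ffunP e; apply/alpha_inj/ffunP => t.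
have /(congr1 val) := e t; rewrite !ffunE /= => et.
by rewrite -[LHS](nth_index 0 (_ : _ \in enum (S t))) ?et ?nth_index //
  mem_enum alphaS.
Qed.

(** The roots in direction [t] are the first [N t] elements of the enumeration of [S t], so a
    nonzero value forces the position of the point to be at least [N t]. *)
Lemma newton_neq0 N j :
  prodrow (newton N) 0 j != 0 -> dvd_exps N (point_index j).
Proof.
rewrite mxE => /prodf_neq0 nz; apply/dvd_expsP => t.
rewrite ffunE /= leqNgt -in_take ?mem_enum ?alphaS //.
by rewrite -root_prod_XsubC; apply: nz.
Qed.

(** * Footprint bounds for subspaces *)

Lemma subn_exps_subproof N M t : (N t - M t < s)%N.
Proof. by apply: leq_ltn_trans (leq_subr _ _) _. Qed.

(** The quotient of [N] by [M]; it has this meaning only when [M] divides [N], since the subtraction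
    truncates. *)
Definition subn_exps N M : D := [ffun t => Ordinal (subn_exps_subproof N M t)].

Lemma subn_expsK N M : dvd_exps M N ->
  forall t, (M t + subn_exps N M t = N t :> nat)%N.
Proof. by move=> /dvd_expsP h t; rewrite ffunE /= subnKC. Qed.

Definition suppset (U : 'M[F]_n) : {set 'I_n} :=
  [set j : 'I_n | [exists u : 'rV[F]_n, (u <= U)%MS && (u 0 j != 0)]].

Lemma pmul_supp (U : 'M[F]_n) u P j :
  (u <= U)%MS -> j \notin suppset U -> pmul u P 0 j = 0.
Proof.
move=> uU; rewrite inE mxE negb_exists => /forallP/(_ u).
by rewrite uU negbK => /eqP ->; rewrite mul0r.
Qed.

(** For a down-set, the leading monomial alone decides whether a nonzero word lies in the code. *)
Definition deglex_ideal (L : {set D}) : Prop :=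
  forall a b, deglex_lt a b -> b \in L -> a \in L.

Lemma cap0_eq0 (U C : 'M[F]_n) u :
  \rank (U :&: C)%MS = 0%N -> (u <= U)%MS -> (u <= C)%MS -> u = 0.
Proof.
move=> /eqP; rewrite mxrank_eq0 => /eqP UC0 uU uC.
by apply/eqP; rewrite -submx0 -UC0 sub_capmx uU.
Qed.

Lemma mul0mx_entry p (G : 'M[F]_(n, p)) k : ((0 : 'rV_n) *m G) 0 k = 0.
Proof. by rewrite mul0mx mxE. Qed.

Lemma primary_bound (L1 L2 : {set D}) (U : 'M[F]_n) :
    deglex_ideal L2 -> (U <= code alpha L1)%MS ->
    \rank (U :&: code alpha L2)%MS = 0%N ->
  exists K : {set D},
    [/\ K \subset L1 :\: L2, #|K| = \rank U & (Dset K <= supp U)%N].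
Proof.
move=> idL2 U1 U2.
pose K := [set N : D | [exists u : 'rV[F]_n, (u <= U)%MS && leadp u N]].
exists K; split.
- apply/subsetP => N; rewrite inE => /existsP[u /andP[uU /andP[uN /forallP u0]]].
  rewrite inE; apply/andP; split; last first.
    have /sub_codeP h := submx_trans uU U1.
    by apply: contraR uN => /h ->.
  (* A lead in [L2] would place the whole word in [code alpha L2], hence in the zero
     intersection. *)
  apply: contra uN => NL2; rewrite (@cap0_eq0 U (code alpha L2) u) //.
    by rewrite /lcoef mul0mx_entry.
  apply/sub_codeP => M ML2; apply/eqP/(implyP (u0 M)).
  have MN : M != N by apply: contraNneq ML2 => ->.
  by case/orP: (deglex_total MN) => // /idL2/(_ NL2); rewrite (negPf ML2).
- apply/eqP; rewrite eqn_leq; apply/andP; split.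
    apply: card_leadp_le_rank => N.
    by rewrite inE => /existsP[u /andP[]]; exists u.
  apply: (rank_le_card_leads (@deglex_irr m s) (@deglex_trans m s)
    (G := pinvmx evmx)) => [u _|]; first exact: coefp_inj.
  by move=> u N uU lu; rewrite inE; apply/existsP; exists u; rewrite uU.
(* Each multiple of a lead is itself the lead of a word supported in [suppset U]. *)
apply: (card_leads_le_card (@deglex_irr m s) (@deglex_trans m s)
  (G := pinvmx evmx) (@deglex_total m s)) => N.
rewrite inE => /existsP[M /andP[]]; rewrite inE => /existsP[u /andP[uU lu]] MN.
exists (pmul u (subn_exps N M)); first by move=> j; apply: pmul_supp.
exact: leadp_pmul lu (subn_expsK MN).
Qed.

Lemma dual_bound (L1 L2 : {set D}) (U : 'M[F]_n) :
    deglex_ideal L1 -> (U <= dual (code alpha L2))%MS ->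
    \rank (U :&: dual (code alpha L1))%MS = 0%N ->
  exists K : {set D},
    [/\ K \subset L1 :\: L2, #|K| = \rank U & (Dperp K <= supp U)%N].
Proof.
move=> idL1 U2 U1.
have irr : irreflexive (fun a b : D => deglex_lt b a) by move=> a; apply: deglex_irr.
have trans : transitive (fun a b : D => deglex_lt b a).
  by move=> b a c ba cb; apply: deglex_trans cb ba.
have total (a b : D) : a != b -> deglex_lt b a || deglex_lt a b.
  by rewrite eq_sym; apply: deglex_total.
pose K := [set N : D | [exists u : 'rV[F]_n, (u <= U)%MS && leadd u N]].
exists K; split.
- apply/subsetP => N; rewrite inE => /existsP[u /andP[uU /andP[uN /forallP u0]]].
  rewrite inE; apply/andP; split.
    have /sub_dual_codeP h := submx_trans uU U2.
    by apply: contra uN => /h ->.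
  (* Here the lead is the smallest monomial with nonzero coordinate. Outside [L1] it exceeds all of
     [L1], so the word would be orthogonal to [code alpha L1]. *)
  apply: contraR uN => NL1; rewrite (@cap0_eq0 U (dual (code alpha L1)) u) //.
    by rewrite /lcoef mul0mx_entry.
  apply/sub_dual_codeP => M ML1; apply/eqP/(implyP (u0 M)).
  have MN : M != N by apply: contraNneq NL1 => <-.
  by case/orP: (deglex_total MN) => // /idL1/(_ ML1); rewrite (negPf NL1).
- apply/eqP; rewrite eqn_leq; apply/andP; split.
    apply: (card_leads_le_rank irr trans (G := evmx^T) total) => N.
    by rewrite inE => /existsP[u /andP[]]; exists u.
  apply: (rank_le_card_leads irr trans (G := evmx^T)) => [u _|]; first exact: coefd_inj.
  by move=> u N uU lu; rewrite inE; apply/existsP; exists u; rewrite uU.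
apply: (card_leads_le_card irr trans (G := evmx^T) total) => N.
rewrite inE => /existsP[M /andP[]]; rewrite inE => /existsP[u /andP[uU lu]] NM.
exists (pmul u (subn_exps M N)); first by move=> j; apply: pmul_supp.
exact: leadd_pmul lu (subn_expsK NM).
Qed.

Lemma primary_bound_sharp (L1 L2 K : {set D}) :
    deglex_ideal L1 -> K \subset L1 :\: L2 ->
  exists U : 'M[F]_n, [/\ (U <= code alpha L1)%MS, \rank U = #|K|,
    \rank (U :&: code alpha L2)%MS = 0%N & (supp U <= Dset K)%N].
Proof.
move=> idL1 /subsetP KL.
pose U := (\sum_(M in K) <<prodrow (newton M)>>)%MS.
have rU : \rank U = #|K|.
  apply/eqP; rewrite eqn_leq rank_sum_rows_le_card /=.
  apply: card_leadp_le_rank => N NK.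
  exists (prodrow (newton N)); last exact: leadp_newton.
  by apply: (sumsmx_sup N); rewrite ?genmxE.
exists U; split=> //.
- apply/sumsmx_subP => M /KL; rewrite inE genmxE => /andP[_ ML1].
  apply/sub_codeP => N NL1; apply/eqP; apply: contraR NL1 => /coefp_newton.
  by move=> /dvd_deglex_le /orP[/eqP->|/idL1]; last apply.
(* The elements of the disjoint sets [L2] and [K] are all leads in the sum of the two spaces; the
   dimension formula then leaves no room for an intersection. *)
- have: (#|L2 :|: K| <= \rank (U + code alpha L2)%MS)%N.
    apply: card_leadp_le_rank => N.
    rewrite inE => /orP[NL2|NK].
      exists (ev N); last exact: leadp_ev.
      apply: submx_trans (addsmxSr _ _).
      by apply: (sumsmx_sup N); rewrite ?genmxE.
    exists (prodrow (newton N)); last exact: leadp_newton.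
    apply: submx_trans (addsmxSl _ _).
    by apply: (sumsmx_sup N); rewrite ?genmxE.
  rewrite cardsU disjoint_setI0 ?cards0 ?subn0; last first.
    rewrite disjoint_sym disjoints_subset; apply/subsetP => M /KL.
    by rewrite !inE => /andP[].
  by have := mxrank_sum_cap U (code alpha L2); rewrite rU rank_code; lia.
(* A coordinate in the support is nonzero in some generator, so its position is a multiple of an
   element of [K]. *)
rewrite /supp -(card_imset _ point_index_inj); apply/subset_leq_card/subsetP => N.
case/imsetP => j; rewrite inE => /existsP[u /andP[uU uj]] ->; rewrite inE.
apply: contraR uj; rewrite negb_exists => /forallP h.
case/sub_sumsmxP: uU => w ->; rewrite summxE big1 // => M MK.
have /sub_rVP[c ->] : (w M *m <<prodrow (newton M)>> <= prodrow (newton M))%MS.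
  by apply: submx_trans (submxMl _ _) _; rewrite genmxE.
rewrite mxE; have [->|/newton_neq0 MN] := eqVneq (prodrow (newton M) 0 j) 0.
  by rewrite mulr0.
by have := h M; rewrite MK => /negP[].
Qed.

Lemma Dset_le (K : {set D}) : (Dset K <= s ^ m)%N.
Proof. by rewrite -card_exps max_card. Qed.

(** The lower bound and its sharpness translate between [U] and [K]. Both minima default to the same
    number [n = s ^ m], so the equality holds even when nothing qualifies. *)
Lemma Mv_code (L1 L2 : {set D}) v :
    deglex_ideal L1 -> deglex_ideal L2 ->
  Mv v (code alpha L1) (code alpha L2) = minsub (@Dset m s) (L1 :\: L2) v.
Proof.
move=> idL1 idL2; apply/eqP; rewrite eqn_leq; apply/andP; split.
  apply: geq_bigminn => [|K /andP[KL /eqP Kv]].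
    by rewrite -card_points bigminn_leq_default.
  have [U [U1 rU U2 supU]] := primary_bound_sharp idL1 KL.
  apply: leq_trans supU; apply: bigminn_leq.
  by rewrite U1 rU Kv U2 !eqxx.
apply: geq_bigminn => [|U /andP[/andP[U1 /eqP rU] /eqP U2]].
  by rewrite [X in (_ <= X)%N]card_points bigminn_leq_default.
have [K [KL Kv supU]] := primary_bound idL2 U1 U2.
by apply: leq_trans supU; apply: bigminn_leq; rewrite KL Kv rU eqxx.
Qed.

Lemma Mv_dual_code_ge (L1 L2 : {set D}) v :
    deglex_ideal L1 ->
  (minsub (@Dperp m s) (L1 :\: L2) v
     <= Mv v (dual (code alpha L2)) (dual (code alpha L1)))%N.
Proof.
move=> idL1; apply: geq_bigminn => [|U /andP[/andP[U2 /eqP rU] /eqP U1]].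
  by rewrite [X in (_ <= X)%N]card_points bigminn_leq_default.
have [K [KL Kv supU]] := dual_bound idL1 U2 U1.
by apply: leq_trans supU; apply: bigminn_leq; rewrite KL Kv rU eqxx.
Qed.

End Evaluation.

(** * The window between the two bounding monomials *)

Section Window.

Variables (m s : nat) (t0 t1 : 'I_m).
Hypotheses (ht0 : val t0 = 0%N) (ht1 : val t1 = 1%N).
Implicit Types a b N : exps m s.

Lemma t1_neq_t0 : t1 != t0.
Proof. by apply/eqP => e; have := ht1; rewrite e ht0. Qed.

Lemma gt1_neq (u : 'I_m) : (1 < u)%N = (u != t0) && (u != t1).
Proof. by rewrite -!val_eqE /= ht0 ht1; case: (val u) => [|[|]]. Qed.

Lemma split_sum01 (f : 'I_m -> nat) :
  (\sum_(t < m) f t = f t0 + f t1 + \sum_(t < m | (1 < t)%N) f t)%N.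
Proof.
rewrite (bigD1 t0) //= (bigD1 t1) ?t1_neq_t0 //= addnA; congr addn.
by apply: eq_bigl => u; rewrite gt1_neq.
Qed.

Lemma split_prod01 (f : 'I_m -> nat) :
  (\prod_(t < m) f t = f t0 * f t1 * \prod_(t < m | (1 < t)%N) f t)%N.
Proof.
rewrite (bigD1 t0) //= (bigD1 t1) ?t1_neq_t0 //= mulnA; congr muln.
by apply: eq_bigl => u; rewrite gt1_neq.
Qed.

(** The line through [b] on which the first two variables trade exponents at constant degree; the
    window is a segment of it. *)
Definition agree a b : Prop :=
  (forall t : 'I_m, (1 < t)%N -> a t = b t) /\ (a t0 + a t1 = b t0 + b t1)%N.

Lemma agree_degsum a b : agree a b -> degsum a = degsum b.
Proof.
move=> [h e]; rewrite /degsum !split_sum01 e; congr addn.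
by apply: eq_bigr => t /h ->.
Qed.

Lemma degsum_agree a b :
  (forall t : 'I_m, (1 < t)%N -> a t = b t) -> degsum a = degsum b -> agree a b.
Proof.
move=> h; rewrite /degsum !split_sum01 => e; split=> //; move: e.
by rewrite (eq_bigr (fun t => b t : nat)) => [/addIn//|t /h ->].
Qed.

(** The exponent at [t1] determines the one at [t0], so distinct monomials of the line have [t1] as
    rightmost place of difference. *)
Lemma agree_deglex_le a b : agree a b -> deglex_le a b = (a t1 <= b t1)%N.
Proof.
have lt a' b' : agree a' b' -> (a' t1 < b' t1)%N -> deglex_lt a' b'.
  move=> ab lt1; apply/deglexP; right; split; first exact: agree_degsum.
  by exists t1 => // u; rewrite ht1; apply: ab.1.
move=> ab; apply/idP/idP => [|].
  apply: contraLR; rewrite -ltnNge => lt1; rewrite negb_or.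
  have ba : deglex_lt b a.
    by apply: lt => //; case: ab => h e; split=> // t /h.
  apply/andP; split; first by apply: contraTneq lt1 => ->; rewrite ltnn.
  by apply/negP => /(deglex_trans ba); rewrite deglex_irr.
rewrite leq_eqVlt => /orP[/eqP e1|/(lt _ _ ab) ltab]; apply/orP; last by right.
left; apply/eqP/ffunP => t; apply/val_inj.
have [t_gt1|] := boolP (1 < t)%N; first by rewrite ab.1.
have := ab.2; rewrite gt1_neq negb_and !negbK => e0 /orP[/eqP->|/eqP->] //=.
by move: e0; rewrite e1 => /addIn.
Qed.

Lemma deglex_leP a b : degsum a = degsum b -> deglex_le a b ->
  a = b \/ exists2 t : 'I_m, (a t < b t)%N & forall u : 'I_m, (t < u)%N -> a u = b u.
Proof.
move=> e /orP[/eqP->|/deglexP[|[_]]]; [by left|by rewrite e ltnn|by right].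
Qed.

Lemma deglex_le_degsum a b : deglex_le a b -> (degsum a <= degsum b)%N.
Proof. by case/orP=> [/eqP->//|/deglexP[/ltnW|[->]]]. Qed.

(** The degree is squeezed. Suppose [N] and [b] differ beyond [t1]: at the later of the two deciding
    positions, one comparison is strict while the other is strict or an equality, although [a] and
    [b] coincide there. *)
Lemma between_agree a N b :
  agree a b -> deglex_le a N -> deglex_le N b -> agree N b.
Proof.
move=> ab aN Nb; have dab := agree_degsum ab.
have dNb : degsum N = degsum b.
  by apply/eqP; rewrite eqn_leq deglex_le_degsum //= -dab deglex_le_degsum.
apply: degsum_agree => // t t_gt1.
case: (deglex_leP dNb Nb) => [->//|[u Nu hu]].
have dNa : degsum a = degsum N by rewrite dNb.
case: (deglex_leP dNa aN) => [<-|[v av hv]]; first exact: ab.1.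
have [u_gt1|u_le1] := ltnP 1 u; last by rewrite hu // (leq_ltn_trans u_le1).
have eu := ab.1 u u_gt1.
have [lt|lt|/val_inj e] := ltngtP u v.
- have := ab.1 v (ltn_trans u_gt1 lt); have := hu v lt => <- e.
  by rewrite e ltnn in av.
- by have := hv u lt => e; rewrite -e eu ltnn in Nu.
by subst v; rewrite eu in av; have := ltn_trans av Nu; rewrite ltnn.
Qed.

Lemma between_agreeE a b N : agree a b ->
  deglex_le a N && deglex_le N b <->
  agree N b /\ (a t1 <= N t1 <= b t1)%N.
Proof.
move=> ab; have tr : agree N b -> agree a N.
  move=> Nb; split=> [t h|]; first by rewrite ab.1 // Nb.1.
  by rewrite ab.2 Nb.2.
split=> [/andP[aN Nb]|[Nb]].
  have ag := between_agree ab aN Nb; split=> //.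
  by rewrite -(agree_deglex_le ag) -(agree_deglex_le (tr ag)) aN.
by rewrite -(agree_deglex_le Nb) -(agree_deglex_le (tr Nb)).
Qed.

End Window.

(** * Down-sets of the order and box counts *)

Lemma deglex_leNgt m s (a b : exps m s) : deglex_le a b = ~~ deglex_lt b a.
Proof.
rewrite /deglex_le; have [->|neq] := eqVneq a b; first by rewrite deglex_irr.
apply/idP/idP => [ab|]; first by apply/negP => /(deglex_trans ab); rewrite deglex_irr.
by case/orP: (deglex_total neq) => // ->.
Qed.

Lemma deglex_ideal_le m s (b : exps m s) : deglex_ideal [set N | deglex_le N b].
Proof.
move=> a c ac; rewrite !inE => /orP[/eqP<-|cb]; apply/orP; right=> //.
exact: deglex_trans cb.
Qed.

Lemma deglex_ideal_lt m s (b : exps m s) : deglex_ideal [set N | deglex_lt N b].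
Proof. by move=> a c ac; rewrite !inE; apply: deglex_trans. Qed.

Lemma card_prod_pred m s (A : 'I_m -> pred 'I_s) :
  #|[set N : exps m s | [forall t, A t (N t)]]| = (\prod_(t < m) #|A t|)%N.
Proof.
rewrite (@eq_card _ _ (family A)) => [|N]; last first.
  by rewrite inE; apply/forallP/familyP.
by rewrite card_family foldrE big_map big_enum.
Qed.

Lemma card_ord_lt s c : (c <= s)%N -> #|[pred k : 'I_s | (k < c)%N]| = c.
Proof.
move=> cs; rewrite -[RHS]card_ord.
have inj : injective (widen_ord cs) by move=> x y /(congr1 val) /= /val_inj.
rewrite -(card_codom inj); apply: eq_card => k; rewrite inE.
apply/idP/codomP => [kc|[x ->]]; last exact: (ltn_ord x).
by exists (Ordinal kc); apply/val_inj.
Qed.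

(** The multiples of one monomial form a box with sides [s - M t]. *)
Lemma Dset1 m s (M : exps m s) : Dset [set M] = (\prod_(t < m) (s - M t))%N.
Proof.
have -> : Dset [set M] = #|[set N : exps m s | [forall t, M t <= N t]%N]|.
  apply: eq_card => N; rewrite !inE; apply/existsP/idP => [[M']|h].
    by rewrite inE => /andP[/eqP->].
  by exists M; rewrite inE eqxx.
rewrite (card_prod_pred (fun t k => M t <= k)%N); apply: eq_bigr => t _.
have := cardC [pred k : 'I_s | (k < M t)%N].
rewrite card_ord card_ord_lt ?(ltnW (ltn_ord _)) // => e; rewrite -[X in (X - _)%N]e addKn.
by apply: eq_card => k; rewrite !inE -leqNgt.
Qed.

Lemma Dperp1 m s (M : exps m s) : Dperp [set M] = (\prod_(t < m) (M t).+1)%N.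
Proof.
have -> : Dperp [set M] = #|[set N : exps m s | [forall t, N t <= M t]%N]|.
  apply: eq_card => N; rewrite !inE; apply/existsP/idP => [[M']|h].
    by rewrite inE => /andP[/eqP->].
  by exists M; rewrite inE eqxx.
rewrite (card_prod_pred (fun t k => k <= M t)%N); apply: eq_bigr => t _.
by rewrite -[RHS](card_ord_lt (ltn_ord (M t))).
Qed.

(** * Codimension and relative weights for the window *)

Unset Implicit Arguments.

Theorem mainTheorem7 (F : finFieldType) (m s n : nat)
  (S : 'I_m -> {set F}) (hS : forall t, #|S t| = s)
  (alpha : 'I_n -> {ffun 'I_m -> F}) (alpha_inj : injective alpha)
  (alpha_onto : forall x : {ffun 'I_m -> F}, (exists j, alpha j = x) <-> (forall t, x t \in S t))
  (t0 t1 : 'I_m) (ht0 : val t0 = 0%N) (ht1 : val t1 = 1%N)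
  (i : exps m s) (hi : (i t0 <= i t1)%N) :
  let i' : exps m s := [ffun t => if t == t0 then i t1 else if t == t1 then i t0 else i t] in
  let L1 := [set N : exps m s | deglex_le N i] in
  let L2 := [set N : exps m s | deglex_lt N i'] in
  let C1 := code alpha L1 in
  let C2 := code alpha L2 in
  let l := ((i t1 - i t0).+1)%N in
  let T := [set N : exps m s | [exists w : 'I_l, [forall t : 'I_m,
              (N t : nat) == (if t == t0 then i t1 - w else if t == t1 then i t0 + w else i t)%N]]] in
  [/\ n = (s ^ m)%N,
      (C2 <= C1)%MS /\ \rank C1 = (\rank C2 + l)%N,
      Mv 1 C1 C2 = (\prod_(t < m) (s - i t))%N,
      (Mv 1 (dual C2) (dual C1) >= \prod_(t < m) (i t).+1)%N
    & forall v : nat, (2 <= v <= l)%N ->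
        Mv v C1 C2 = minsub (@Dset m s) T v /\
        (Mv v (dual C2) (dual C1) >= minsub (@Dperp m s) T v)%N].
Proof.
move=> i' L1 L2 C1 C2 l T.
have t10 := t1_neq_t0 ht0 ht1.
have i't0 : i' t0 = i t1 by rewrite ffunE eqxx.
have i't1 : i' t1 = i t0 by rewrite ffunE (negPf t10) eqxx.
(* [i'] is the end [w = 0] of the window and [i] the end [w = l - 1]. *)
have i'i : agree t0 t1 i' i.
  split=> [t|]; last by rewrite i't0 i't1 addnC.
  by rewrite (gt1_neq ht0 ht1) ffunE => /andP[/negPf-> /negPf->].
have TP N : reflect (agree t0 t1 N i /\ (i t0 <= N t1 <= i t1)%N) (N \in T).
  rewrite inE; apply: (iffP existsP) => [[w /forallP hw]|[[h e] b]].
    have w_lt : (w < (i t1 - i t0).+1)%N := ltn_ord w.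
    have /eqP := hw t0; have /eqP := hw t1; rewrite !eqxx (negPf t10) => e1 e0.
    split; last by lia.
    split=> [t|]; last by lia.
    rewrite (gt1_neq ht0 ht1) => /andP[/negPf n0 /negPf n1].
    by apply/val_inj/eqP; have := hw t; rewrite n0 n1.
  (* The parameter is read off from the exponent at [t1]. *)
  have w_lt : (N t1 - i t0 < l)%N by rewrite /l; lia.
  exists (Ordinal w_lt); apply/forallP => t /=.
  have [->|n0] := eqVneq t t0; first by lia.
  have [->|n1] := eqVneq t t1; first by lia.
  by rewrite h // (gt1_neq ht0 ht1) n0.
(* By totality of the order, [L1 :\: L2] is the closed interval from [i'] to [i]. *)
have TE : L1 :\: L2 = T.
  apply/setP => N; rewrite 3!inE -deglex_leNgt.
  have := between_agreeE ht0 ht1 N i'i; rewrite i't1 => -[h1 h2].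
  exact/idP/TP.
have L21 : L2 \subset L1.
  apply/subsetP => N; rewrite !inE => Ni'.
  have : deglex_le i' i by rewrite (agree_deglex_le ht0 ht1 i'i) i't1.
  case/orP=> [/eqP e|lti]; apply/orP; right; first by rewrite -e.
  exact: deglex_trans lti.
have iT : i \in T by apply/TP; split; [split | lia].
have idL1 : deglex_ideal L1 by apply: deglex_ideal_le.
have idL2 : deglex_ideal L2 by apply: deglex_ideal_lt.
have cardT : #|T| = l.
  have f_lt (w : 'I_l) t :
      ((if t == t0 then i t1 - w else if t == t1 then i t0 + w else i t) < s)%N.
    have w_lt : (w < (i t1 - i t0).+1)%N := ltn_ord w.
    have := ltn_ord (i t1).
    by case: ifP => _; [lia|case: ifP => _ //; lia].
  pose f w : exps m s := [ffun t => Ordinal (f_lt w t)].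
  rewrite -[RHS]card_ord -(card_imset predT (_ : injective f)).
    apply: eq_card => N; rewrite inE; apply/existsP/imsetP.
      case=> w /forallP hw; exists w => //; apply/ffunP => t; apply/val_inj/eqP.
      by rewrite ffunE hw.
    by case=> w _ ->; exists w; apply/forallP => t; rewrite ffunE.
  move=> w w' /ffunP/(_ t1)/(congr1 val); rewrite !ffunE /= eqxx (negPf t10).
  by move/addnI/val_inj.
have MvE v : Mv v C1 C2 = minsub (@Dset m s) T v.
  by rewrite (Mv_code hS alpha_inj alpha_onto v idL1 idL2) TE.
have Mvd v : (minsub (@Dperp m s) T v <= Mv v (dual C2) (dual C1))%N.
  by rewrite -TE; apply: (Mv_dual_code_ge hS alpha_inj alpha_onto).
split=> //.
- exact: (card_points hS alpha_inj alpha_onto).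
- split.
    apply/sumsmx_subP => N /(subsetP L21) NL1; apply: (sumsmx_sup N) => //.
  rewrite !(rank_code hS alpha_inj alpha_onto) -cardT -TE.
  by rewrite -(cardsID L2 L1) (setIidPr L21).
- rewrite MvE; apply/eqP; rewrite eqn_leq -{1}Dset1; apply/andP; split.
    (* The end [i] of the window attains the product. *)
    by apply: bigminn_leq; rewrite sub1set iT cards1.
  apply: geq_bigminn => [|K /andP[KT /cards1P[M KM]]].
    by rewrite -Dset1 Dset_le.
  have /TP[[h e] b] : M \in T by rewrite -sub1set -KM.
  rewrite KM Dset1 !(split_prod01 ht0 ht1).
  have -> : (\prod_(t < m | (1 < t)%N) (s - M t) =
      \prod_(t < m | (1 < t)%N) (s - i t))%N by apply: eq_bigr => t /h ->.
  apply: leq_mul => //.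
  (* The exponents of [M] and [i] have equal sums, so the two sides differ by
     [(M t1 - i t0) * (i t1 - M t1)], which is nonnegative; the bounds by [s] keep the truncated
     subtractions exact. *)
  have := ltn_ord (i t0); have := ltn_ord (i t1); move: e b; nia.
apply: leq_trans (Mvd 1%N); apply: geq_bigminn => [|K /andP[KT /cards1P[M KM]]].
  (* The default value [s ^ m] must also respect the bound: every factor [(i t).+1] is at most
     [s]. *)
  rewrite -[X in (_ <= X ^ _)%N](card_ord s) -[X in (_ <= _ ^ X)%N](card_ord m).
  by rewrite -prod_nat_const; apply: leq_prod => t _; rewrite card_ord.
have /TP[[h e] b] : M \in T by rewrite -sub1set -KM.
rewrite KM Dperp1 !(split_prod01 ht0 ht1).
have -> : (\prod_(t < m | (1 < t)%N) (M t).+1 =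
    \prod_(t < m | (1 < t)%N) (i t).+1)%N by apply: eq_bigr => t /h ->.
(* The difference is again [(M t1 - i t0) * (i t1 - M t1)]. *)
apply: leq_mul => //; move: e b; nia.
Qed.
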